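(* Let $p$ be a prime. Suppose $G$ is an Isaacs group of degree $p^2$ with unique minimal normal subgroup $N$, where $G$ is not $p$-closed. Then the following hold: (1) $G$ has a normal $p$-subgroup $K$ of order $p^5$ such that $Z(K) = N$ and either: (a) $K' = Z(K) = N$ (but $K$ is not semi-extraspecial), or (b) $K' = Z_2(K)$ has order $p^3$ and $Z(K) = [K',K] = N$. (2) $G/K \cong \mathrm{SL}(2,p)$ and $G/K$ acts on $N$ as its natural module. (3) If $p$ is odd, let $S$ be a Sylow $2$-subgroup of $G$ and let $Z$ be the unique subgroup of order $2$ in $S$; then $G = K N_G(Z)$, where $G/K \cong \mathrm{SL}(2,p)$ and $N_G(Z) \cap K = C_K(Z)$ is cyclic of order $p$. Taking $C = C_K(Z)N$, we have $K' \le C$, $C$ is normal in $G$, and $C$ is abelian. (4) If $\lambda \in \mathrm{Irr}(N)$ is nonprincipal, then $G$ acts transitively on $\mathrm{Irr}(K \mid \lambda)$, in the sense that any two members of $\mathrm{Irr}(K \mid \lambda)$ are conjugate under $G$.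
   Context: All groups are finite. For an integer $e > 1$, a group $G$ is an Isaacs group of degree $e$ if $|G| = e^4 - e^3$ and $d = e^2 - e$ is the degree of some irreducible complex character of $G$ (so that $|G| = d(d+e)$). It is known that an Isaacs group of degree $e = p^2$ has a unique minimal normal subgroup $N$, that $N$ is elementary abelian of order $p^2$, and that every nontrivial $p'$-subgroup of $G$ acts fixed-point-freely on $N$ by conjugation (so that for $p$ odd a Sylow $2$-subgroup has a unique subgroup of order $2$). A group is $p$-closed if it has a normal Sylow $p$-subgroup. $K'$ is the derived subgroup of $K$, and $Z_2(K)$ is the second center, i.e. $Z_2(K)/Z(K) = Z(K/Z(K))$. A $p$-group $P$ is semi-extraspecial if $P/M$ is extraspecial for every maximal subgroup $M$ of $Z(P)$. $\mathrm{Irr}(N)$ is the set of irreducible complex characters of $N$, and $\mathrm{Irr}(K \mid \lambda)$ is the set of irreducible characters of $K$ whose restriction to $N$ has $\lambda$ as a constituent; $G$ acts on $\mathrm{Irr}(K)$ by conjugation. In (2)–(4), $K$ is the subgroup from (1). *)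

(* Defs.v *)
From HB Require Import structures.
From mathcomp Require Import all_boot all_order all_algebra all_fingroup.
From mathcomp Require Import all_solvable all_field all_character.

Set Implicit Arguments.
Unset Strict Implicit.
Unset Printing Implicit Defensive.

Import GroupScope GRing.Theory.

Definition isaacs_group (gT : finGroupType) (G : {group gT}) (e : nat) : Prop :=
  [/\ (1 < e)%N, #|G| = (e ^ 4 - e ^ 3)%N
    & exists i : Iirr G, ('chi_i 1%g = (e ^ 2 - e)%N%:R)%R].

(* minnormal does not require containment in the ambient group. *)
Definition unique_min_normal (gT : finGroupType) (N G : {group gT}) : Prop :=
  [/\ N \subset G, minnormal N G
    & forall M : {group gT}, M \subset G -> minnormal M G -> M :=: N].

Definition p_closed (p : nat) (gT : finGroupType) (G : {group gT}) : Prop :=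
  exists P : {group gT}, p.-Sylow(G) P /\ P <| G.

Definition semi_extraspecial (p : nat) (gT : finGroupType) (P : {group gT}) :
    Prop :=
  p.-group P /\
  forall M : {group gT}, maximal M 'Z(P) -> extraspecial (P / M).

Definition unique_subgroup_of_order (gT : finGroupType) (n : nat)
    (Z S : {group gT}) : Prop :=
  [/\ Z \subset S, #|Z| = n
    & forall Y : {group gT}, Y \subset S -> #|Y| = n -> Y :=: Z].

Section SpecialLinear.

Variable p : nat.

Definition SL2 : {set {'GL_2['F_p]}} := [set u | (\det (GLval u) == 1)%R].

Lemma SL2_group_set : group_set SL2.
Proof.
apply/group_setP; split=> [|u v]; rewrite !inE ?GL_1E ?det1 //.
by move=> /eqP du /eqP dv; rewrite GL_ME det_mulmx du dv mulr1.
Qed.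

Canonical SL2_group := Group SL2_group_set.

End SpecialLinear.

(* SL(2,p) acts on row vectors from the right, matching the right action of
   G on N by conjugation.  The same isomorphism G / K -> SL(2,p) is used to
   identify the groups and to compare the actions; the action of G / K on N is
   conjugation by coset representatives.  The morphism phi lands in the
   additive group of row vectors, and an additive bijection is 'F_p-linear. *)
Definition acts_as_natural_SL2_module (p : nat) (gT : finGroupType)
    (G K N : {group gT}) : Prop :=
  exists f : {morphism G / K >-> {'GL_2['F_p]}},
    isom (G / K) (SL2 p) f /\
    exists phi : {morphism N >-> 'rV['F_p]_2},
      isom N [set: 'rV['F_p]_2] phi /\
      {in N & G, forall x g, phi (x ^ g) = (phi x *m GLval (f (coset K g)))%R}.

(* Main.v *)
Require Import Defs.
From mathcomp Require Import all_boot all_order all_algebra all_fingroup.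
From mathcomp Require Import ring.
From mathcomp Require Import all_solvable all_field all_character.

(** Put e = p ^ 2 and let chi be the irreducible character of degree e(e - 1).
The other irreducible characters have squared degrees summing to e^2(e - 1),
less than the p-part e^3 of |G|, so they cannot fill a union of p-blocks that
avoids chi.  Hence G has a single p-block, and chi does not vanish on the center
of a Sylow p-subgroup P.  Since chi is rational valued, the integer
|z^G| chi(z) / chi(1) is nonzero for 1 <> z in Z(P), and the norm of chi then
forces |z^G| = e - 1 and chi = 0 off {1} u z^G = N; every other irreducible
character of G has N in its kernel.  So the characters of K lying over a
nonprincipal character of N are all constituents of chi_K, which gives (4) by
Clifford's theorem.

Now C_G(n) is a Sylow p-subgroup for each 1 <> n in N, and K = C_G(N) has index p
in it because G is not p-closed.  Thus C_G(n) induces on N all transvections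
fixing n; these generate SL(2,p), and G has no proper subgroup containing
all the C_G(n).  In particular G centralizes its normal sections of order p.
Combined with coprime action (of an involution, or of an element of order 3 when
p = 2) this determines Z(K), K' and C_K(Z). *)

Set Implicit Arguments.
Unset Strict Implicit.
Unset Printing Implicit Defensive.

Import Order.TTheory GroupScope GRing.Theory Num.Theory.

(** * Newton's identities and divisibility *)

Section Newton.

Local Open Scope ring_scope.

Lemma deriv_prod_XsubC (F : fieldType) (s : seq F) :
  (\prod_(r <- s) ('X - r%:P))^`()
    = \sum_(r <- s) (\prod_(r <- s) ('X - r%:P)) %/ ('X - r%:P).
Proof.
elim: s => [|a s IHs]; first by rewrite !big_nil -polyC1 derivC.
rewrite !big_cons derivM derivXsubC mul1r IHs mulr_sumr; congr (_ + _).
  by rewrite mulKp // polyXsubC_eq0.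
apply: eq_big_seq => r s_r; rewrite divp_mulA //.
by rewrite (big_rem r s_r) dvdp_mulr.
Qed.

(** Synthetic division: the quotient satisfies [q_k = g_(k+1) + r * q_(k+1)], and unrolling this
    recurrence past the degree leaves the sum. *)
Lemma coef_divp_XsubC (F : fieldType) (g : {poly F}) (r : F) (n j : nat) :
    root g r -> (size g <= n)%N ->
  (g %/ ('X - r%:P))`_j = \sum_(i < n) g`_(j.+1 + i) * r ^+ i.
Proof.
move=> gr0 le_g_n; set q := g %/ _.
have Dg: g = q * ('X - r%:P) by rewrite divpK // dvdp_XsubCl.
have q_rec k : q`_k = g`_k.+1 + r * q`_k.+1.
  by rewrite [in g`__]Dg mulrBr coefB coefMX coefMC /= mulrC subrK.
have q_exp m : q`_j = \sum_(i < m) g`_(j.+1 + i) * r ^+ i + r ^+ m * q`_(j + m).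
  elim: m => [|m IHm]; first by rewrite big_ord0 add0r mul1r addn0.
  rewrite IHm big_ord_recr /= -addrA q_rec addSn mulrDr addnS; congr (_ + _).
  by rewrite mulrA -exprSr [r ^+ m * g`__]mulrC.
rewrite (q_exp n) [q`_(j + n)]nth_default ?mulr0 ?addr0 //.
rewrite size_divp ?polyXsubC_eq0 // size_XsubC subn1.
by rewrite (leq_trans (leq_pred _)) // (leq_trans le_g_n) ?leq_addl.
Qed.

(** Newton's identities, read off from the derivative of [g] as the sum of the quotients
    [g / (X - r)]. The term [i = 0] is [size s] times the [k]-th coefficient; for [k = 0] the
    identity only says that [g] vanishes at its roots. *)
Lemma coef_prod_XsubC_Newton (F : fieldType) (s : seq F) (k : nat) :
  let g := \prod_(r <- s) ('X - r%:P) in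
  g`_k *+ k = \sum_(i < (size s).+1) g`_(k + i) * \sum_(r <- s) r ^+ i.
Proof.
move=> g; have szg: size g = (size s).+1 by rewrite size_prod_XsubC.
have root_g r : r \in s -> root g r by rewrite root_prod_XsubC.
under eq_bigr do rewrite mulr_sumr.
rewrite exchange_big; case: k => [|k] /=.
  rewrite mulr0n big1_seq // => r /andP[_ /root_g/eqP gr0].
  by rewrite -[RHS]gr0 horner_coef szg.
rewrite -coef_deriv deriv_prod_XsubC coef_sum.
apply: eq_big_seq => r /root_g gr0.
by rewrite (@coef_divp_XsubC _ _ _ (size s).+1) ?szg.
Qed.

(* Newton's identities give [p ^ a | (M - k) g_k] for the coefficients [g_k] of
   the degree [M] polynomial [g] with roots [s]; as [0 < M - k < p ^ a], each
   nonleading [g_k] is divisible by [p]. *)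
Lemma Newton_dvd_root (p a : nat) (s : seq algC) :
    prime p -> {subset s <= Aint} -> (size s < p ^ a)%N ->
    (forall n, (0 < n)%N -> (\sum_(r <- s) r ^+ n) / (p ^ a)%:R \in Aint) ->
  {in s, forall r, r ^+ size s / p%:R \in Aint}.
Proof.
move=> p_pr Zs lt_s_pa Zpow r s_r; set M := size s in lt_s_pa *.
set g := \prod_(r <- s) ('X - r%:P).
have szg: size g = M.+1 by rewrite size_prod_XsubC.
have Zg k : g`_k \in Aint.
  suffices /polyOverP: g \is a polyOver Aint by [].
  by rewrite /g big_seq rpred_prod // => x /Zs Zx; rewrite polyOverXsubC.
have nz_p n : (p ^ n)%:R != 0 :> algC.
  by rewrite pnatr_eq0 -lt0n expn_gt0 prime_gt0.
have Zg_pa k : (k < M)%N -> (g`_k *+ (M - k)) / (p ^ a)%:R \in Aint.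
  move=> lt_kM.
  have /= := coef_prod_XsubC_Newton s k; rewrite -/g big_ord_recl /= addn0.
  under [in X in _ = X + _]eq_bigr do rewrite expr0.
  rewrite big_const_seq count_predT iter_addr_0 mulr_natr -/M => Egk.
  have{Egk} ->: g`_k *+ (M - k)
      = - \sum_(i < M) g`_(k + i.+1) * \sum_(r <- s) r ^+ i.+1.
    by rewrite mulrnBr 1?ltnW // Egk opprD addrA subrr add0r.
  rewrite mulNr rpredN mulr_suml rpred_sum // => i _.
  by rewrite -mulrA rpredM // Zpow.
have Zg_p k : (k < M)%N -> g`_k / p%:R \in Aint.
  move=> lt_kM; have /Zg_pa := lt_kM; set m := (M - k)%N.
  have pa_gt0: (0 < p ^ a)%N by rewrite expn_gt0 prime_gt0.
  have lt_m_pa: (m < p ^ a)%N by rewrite (leq_ltn_trans (leq_subr _ _)).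
  (* The gcd of [p ^ a] and [m] is [p ^ v] with [v < a], because [0 < m < p ^ a]. By Bezout, [p ^ a]
     divides [p ^ v] times the coefficient. *)
  have [u _ /dvdnP[q Eq]] := Bezoutl m pa_gt0.
  have /(dvdn_pfactor _ _ p_pr)[v le_va Dv] := dvdn_gcdl (p ^ a) m.
  have lt_va: (v < a)%N.
    rewrite -(ltn_exp2l _ _ (prime_gt1 p_pr)) -Dv.
    by rewrite (leq_ltn_trans _ lt_m_pa) // dvdn_leq ?subn_gt0 ?dvdn_gcdr.
  rewrite -[g`_k *+ m]mulr_natr => Zgm.
  have Dpa: (p ^ a)%:R = p%:R * (p ^ v)%:R * (p ^ (a - v.+1))%:R :> algC.
    by rewrite -!natrM -expnS -expnD subnKC.
  have ->: g`_k / p%:R = (g`_k * (p ^ v)%:R) / (p ^ a)%:R * (p ^ (a - v.+1))%:R.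
    by rewrite Dpa; field; rewrite !nz_p -[p]expn1 nz_p.
  have ->: (p ^ v)%:R = q%:R * (p ^ a)%:R - m%:R * u%:R :> algC.
    by apply/(canRL (addrK _)); rewrite -!natrM -natrD -Eq Dv mulnC.
  have ->: g`_k * (q%:R * (p ^ a)%:R - m%:R * u%:R) / (p ^ a)%:R
     = g`_k * q%:R - g`_k * m%:R / (p ^ a)%:R * u%:R by field.
  have Znat n : n%:R \in Aint := rpred_nat _ n.
  by apply: rpredM => //; apply: rpredB; apply: rpredM.
have gr0: g.[r] = 0 by apply/eqP; rewrite -[_ == _]/(root g r) root_prod_XsubC.
have Mg: g`_M = 1.
  by have /monicP := monic_prod_XsubC s xpredT id; rewrite -/g lead_coefE szg.
move: gr0; rewrite horner_coef szg big_ord_recr /= Mg mul1r.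
move=> /(canRL (addKr _)) ->.
rewrite addr0 mulNr rpredN mulr_suml rpred_sum // => i _.
by rewrite mulrAC rpredM ?Zg_p ?rpredX ?Zs.
Qed.
End Newton.

(** * Class sums *)

Section Block.

Variables (gT : finGroupType) (G : {group gT}).
Local Open Scope ring_scope.

(** Class multiplication has natural structure constants and central characters are multiplicative,
    so one [m] serves all [i]; this permits summing over [i]. *)
Lemma gring_irr_mode_exp (k : 'I_#|classes G|) (n : nat) :
  exists m : 'I_#|classes G| -> nat,
    forall i : Iirr G,
      'omega_i['K_k] ^+ n = \sum_l (m l)%:R * 'omega_i['K_l].
Proof.
elim: n => [|n [m Dm]].
  pose k1 := enum_rank_in (classes1 G) 1%g.
  exists (fun l => (l == k1) : nat) => i.
  rewrite (bigD1 k1) //= big1 => [|l /negPf->]; last by rewrite mul0r.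
  rewrite eqxx mul1r addr0 expr0 (@gring_mode_class_sum_eq _ _ _ _ 1%g).
    by rewrite mulfK ?irr1_neq0 // class1G cards1.
  by rewrite enum_rankK_in ?classes1 ?set11.
exists (fun l => \sum_j m j * gring_classM_coef j k l)%N => i.
rewrite exprSr Dm mulr_suml.
transitivity (\sum_j \sum_l
   (m j * gring_classM_coef j k l)%:R * 'omega_i['K_l]).
  apply: eq_bigr => j _; rewrite -mulrA.
  rewrite -gring_irr_modeM ?gring_class_sum_central // gring_classM_expansion.
  rewrite raddf_sum mulr_sumr; apply: eq_bigr => l _.
  by rewrite /= xcfunZr natrM mulrA.
by rewrite exchange_big; apply: eq_bigr => l _; rewrite -mulr_suml natr_sum.
Qed.

(** After expansion in class sums, the regular character kills every class but that of 1, which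
    contributes a multiple of [#|G|]. *)
Lemma sum_irr_mode_exp (k : 'I_#|classes G|) (n : nat) :
  (\sum_i 'chi[G]_i 1%g ^+ 2 * 'omega_i['K_k] ^+ n) / #|G|%:R \in Aint.
Proof.
have [m Dm] := gring_irr_mode_exp k n.
under eq_bigr do rewrite Dm mulr_sumr.
rewrite exchange_big mulr_suml rpred_sum //= => l _.
have Kl := enum_valP l; have [x Gx DxG] := imsetP Kl.
under eq_bigr => i _.
  rewrite (@gring_mode_class_sum_eq _ _ _ _ x) ?DxG ?class_refl //.
  have -> : 'chi_i 1%g ^+ 2
        * ((m l)%:R * (#|x ^: G|%:R * 'chi_i x / 'chi_i 1%g))
      = (m l * #|x ^: G|)%:R * ('chi_i 1%g *: 'chi_i) x :> algC.
    by rewrite cfunE natrM; field; rewrite irr1_neq0.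
  over.
rewrite -mulr_sumr -sum_cfunE -cfReg_sum cfRegE mulrAC.
case: eqP => _; last by rewrite mulr0 rpred0.
by rewrite mulr1n divfK ?neq0CG ?rpred_nat.
Qed.

(* If [chi_c z = 0], the class sum of [z] acts by 0 through [chi_c], so the power
   sums of its [\sum_(i != c) 'chi_i 1 ^ 2 < p ^ a] other eigenvalues are multiples
   of [#|G|], and its eigenvalue [#|z ^: G|] for the principal character would be
   divisible by [p]. *)
Lemma irr_neq0_one_block (p a : nat) (c : Iirr G) (z : gT) :
    prime p -> (p ^ a %| #|G|)%N ->
    \sum_(i | i != c) 'chi[G]_i 1%g ^+ 2 < (p ^ a)%:R ->
    z \in G -> ~~ (p %| #|z ^: G|)%N ->
  'chi_c z != 0.
Proof.
move=> p_pr pa_G lt_sum Gz p'zG; apply/eqP=> chi_z0.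
have nz_c : c != 0.
  by apply/eqP=> c0; have /eqP := chi_z0; rewrite c0 irr0 cfun1E Gz oner_eq0.
have zG_K := mem_classes Gz; pose k := enum_rank_in zG_K (z ^: G).
have k_z: z \in enum_val k by rewrite enum_rankK_in // class_refl.
pose w i := 'omega_i['K_k]; pose d (i : Iirr G) := irr_degree (socle_of_Iirr i).
have Dw i : w i = #|z ^: G|%:R * 'chi_i z / 'chi_i 1%g.
  exact: gring_mode_class_sum_eq.
pose s := flatten [seq nseq (d i ^ 2) (w i) | i <- enum (predC1 c)].
have sum_s F :
  \sum_(r <- s) F r = \sum_(i | i != c) 'chi_i 1%g ^+ 2 * F (w i) :> algC.
  rewrite big_flatten big_map big_enum; apply: eq_bigr => i _.
  by rewrite big_nseq iter_addr_0 irr1_degree -natrX mulr_natl.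
have sz_s : (size s)%:R = \sum_(i | i != c) 'chi_i 1%g ^+ 2 :> algC.
  rewrite -sum1_size natr_sum sum_s.
  by apply: eq_bigr => i _; apply: mulr1.
have lt_s : (size s < p ^ a)%N by rewrite -ltC_nat sz_s.
have Zs : {subset s <= Aint}.
  move=> r /flattenP[_ /mapP[i _ ->]] /nseqP[-> _].
  exact: Aint_gring_mode_class_sum.
have Zpow n : (0 < n)%N -> (\sum_(r <- s) r ^+ n) / (p ^ a)%:R \in Aint.
  move=> n_gt0; rewrite sum_s.
  have wc0: w c = 0 by rewrite Dw chi_z0 mulr0 mul0r.
  have -> : \sum_(i | i != c) 'chi_i 1%g ^+ 2 * w i ^+ n
    = \sum_i 'chi_i 1%g ^+ 2 * w i ^+ n.
    by rewrite [RHS](bigD1 c) //= wc0 expr0n gtn_eqF // mulr0 add0r.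
  have [m Dm] := dvdnP pa_G.
  have nz_m : m%:R != 0 :> algC.
    by apply: contraTneq (cardG_gt0 G) => /eqP; rewrite pnatr_eq0 Dm => /eqP->.
  have := rpredM (rpred_nat Aint m) (sum_irr_mode_exp k n).
  by rewrite Dm natrM invfM mulrCA mulVKf.
have s_z : #|z ^: G|%:R \in s.
  apply/flattenP; exists (nseq (d 0 ^ 2) (w 0)).
    by apply/mapP; exists 0; rewrite // mem_enum inE eq_sym.
  rewrite mem_nseq expn_gt0 irr_degree_gt0 Dw irr0 !cfun1E group1 Gz mulr1.
  by rewrite divr1 eqxx.
have := Newton_dvd_root p_pr Zs lt_s Zpow s_z.
rewrite -natrX => Zdiv.
have nz_p: p%:R != 0 :> algC by rewrite pnatr_eq0 -lt0n prime_gt0.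
have : (p %| (#|z ^: G| ^ size s)%N)%C.
  by rewrite unfold_in (negPf nz_p) Cint_rat_Aint // rpred_div ?rpred_nat.
by rewrite dvdC_nat Euclid_dvdX // (negPf p'zG).
Qed.
End Block.

(** * The character of large degree *)

Section Isaacs.

Variables (gT : finGroupType) (G : {group gT}).
Local Open Scope ring_scope.

(** A Galois conjugate of ['chi_c] is irreducible of the same degree, hence equal to it, so the
    values are rational algebraic integers. *)
Lemma Cint_irr_unique_degree (c : Iirr G) :
    (forall i, 'chi_i 1%g = 'chi_c 1%g -> i = c) ->
  forall x, 'chi_c x \in Num.int.
Proof.
move=> uniq_c x; apply: Cint_rat_Aint; last exact: Aint_irr.
have fix_c (u : {rmorphism algC -> algC}) : u ('chi_c x) = 'chi_c x.
  rewrite -[in RHS](uniq_c (aut_Iirr u c)) ?aut_IirrE ?cfunE //.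
  by rewrite aut_natr ?Cnat_irr1.
have [Qn galQn [QnC gQnC [_ _ Qn_x]]] := group_num_field_exists <[x]>.
have [a Da] := Qn_x _ G _ (irr_char c) x (dvdnn _).
suffices /vlineP[q /= Dq]: a \in 1%VS.
  by rewrite -Da Dq alg_num_field fmorph_rat rpred_rat.
have /galois_fixedField <- := galQn.
apply/fixedFieldP=> [|nu _]; first exact: memvf.
by apply: (fmorph_inj QnC); case: (gQnC nu) => u /= ->; rewrite Da fix_c.
Qed.

Lemma irr_Gagola_subgroup (p e : nat) (c : Iirr G) :
    prime p -> p.-nat e -> (2 < e)%N -> #|G| = (e ^ 3 * (e - 1))%N ->
    'chi_c 1%g = (e * (e - 1))%:R ->
  exists N : {group gT},
    [/\ N <| G, #|N| = e, {in N^#, forall x, x ^: G = N^#}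
      & forall i, i != c -> N \subset cfker 'chi_i].
Proof.
move=> p_pr p_e e_gt2 oG chi1.
have e_gt0 : (0 < e)%N by rewrite (ltn_trans _ e_gt2).
have e1_gt1 : (1 < e - 1)%N by rewrite ltn_subRL.
have e1_gt0 : (0 < e - 1)%N by rewrite ltnW.
set E : algC := e%:R.
have De1 : (e - 1)%:R = E - 1 by rewrite natrB // (ltn_trans _ e_gt2).
have oG' : #|G|%:R = E ^+ 3 * (E - 1) by rewrite oG natrM natrX De1.
have d1 : 'chi_c 1%g = E * (E - 1) by rewrite chi1 natrM De1.
have reg1 x : \sum_i 'chi[G]_i 1%g * 'chi_i x = #|G|%:R *+ (x == 1%g).
  rewrite -cfRegE cfReg_sum sum_cfunE.
  by apply: eq_bigr => i _; apply/esym/cfunE.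
have sumD : \sum_(i | i != c) 'chi[G]_i 1%g ^+ 2 = (e ^ 2 * (e - 1))%:R.
  have := reg1 1%g; rewrite eqxx (bigD1 c) //= oG' d1 => /(canRL (addKr _)) sumD.
  rewrite (eq_bigr (fun i => 'chi_i 1%g * 'chi_i 1%g)) // sumD natrM natrX De1.
  ring.
(* A second such character would contribute [e ^ 2 * (e - 1) ^ 2], which exceeds the sum
   [e ^ 2 * (e - 1)] because [1 < e - 1]. *)
have uniq_c i : 'chi_i 1%g = 'chi_c 1%g -> i = c.
  move=> eq_i; apply/eqP/negPn/negP => ne_ic; have := sumD.
  rewrite (bigD1 i) //= eq_i chi1 => /(canRL (addKr _)).
  rewrite addrC => sum_i.
  have: 0 <= (e ^ 2 * (e - 1))%:R - (e * (e - 1))%:R ^+ 2 :> algC.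
    rewrite -sum_i sumr_ge0 // => j _.
    by rewrite exprn_ge0 // char1_ge0 ?irr_char.
  rewrite -natrX subr_ge0 ler_nat leqNgt expnMn ltn_pmul2l ?expn_gt0 ?e_gt0 //.
  by rewrite -{1}[(e - 1)%N]expn1 ltn_exp2l ?e1_gt1.
have Zchi := Cint_irr_unique_degree uniq_c.
have nz_c : c != 0.
  apply/eqP => c0; have /eqP := chi1; rewrite c0 irr0 cfun11 (eqr_nat _ 1).
  by rewrite eq_sym muln_eq1 => /andP[_ /eqP e1]; move: e1_gt1; rewrite e1.
have [P sylP] := Sylow_exists p G; have [sPG pP p'GP] := and3P sylP.
have [a De] : {a | e = p ^ a}%N by apply/p_natP.
have p'e1 : ~~ (p %| e - 1)%N.
  have : (p %| e)%N.
    rewrite De Euclid_dvdX // dvdnn /=.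
    by case: a De => // De; move: e_gt2; rewrite De.
  by move=> p_dv_e; rewrite dvdn_subr // dvdn1 gtn_eqF ?prime_gt1.
have oP : #|P| = (e ^ 3)%N.
  rewrite (card_Hall sylP) oG partnM ?expn_gt0 ?e_gt0 ?e1_gt0 //.
  by rewrite part_pnat_id ?pnatX ?p_e // part_p'nat ?muln1 // p'natE.
have ntP : P :!=: 1%g.
  by rewrite -cardG_gt1 oP -[1%N](exp1n 3) ltn_exp2r // (ltn_trans _ e_gt2).
have /trivgPn[z /setIP[Pz cPz] nt_z]: 'Z(P) != 1%g.
  by rewrite center_nil_eq1 // (pgroup_nil pP).
have Gz := subsetP sPG z Pz.
(* [P] centralizes [z], so the class size divides [#|G : P| = e - 1]. *)
have m_dvd : (#|z ^: G| %| e - 1)%N.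
  have sPC : P \subset 'C_G[z] by rewrite subsetI sPG sub_cent1.
  have := Lagrange_index (subsetIl G 'C[z]) sPC; rewrite index_cent1 => /esym.
  have /eqP := Lagrange sPG; rewrite oP oG eqn_pmul2l ?expn_gt0 ?e_gt0 //.
  by move=> /eqP-> ->; rewrite dvdn_mulr.
have chiz : 'chi_c z != 0.
  apply: (@irr_neq0_one_block _ _ p (a * 3)) => //.
  - by rewrite expnM -De oG dvdn_mulr.
  - rewrite sumD ltr_nat expnM -De [(e ^ 3)%N]expnSr.
    by rewrite ltn_pmul2l ?expn_gt0 ?e_gt0 // subn1 prednK.
  by apply: contra p'e1 => /dvdn_trans; apply.
set m := #|z ^: G| in m_dvd.
have m_gt0 : (0 < m)%N by rewrite /m -index_cent1 indexg_gt0.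
have le_me : (m <= e - 1)%N by rewrite dvdn_leq.
have nz_d : 'chi_c 1%g != 0 by apply: irr1_neq0.
have Zw : m%:R * 'chi_c z / 'chi_c 1%g \in Num.int.
  apply: Cint_rat_Aint; last exact: Aint_class_div_irr1.
  by rewrite rpred_div ?rpredM ?rpred_nat // rpred_int_num ?Zchi.
have w_ge1 : 1 <= (m%:R * 'chi_c z / 'chi_c 1%g) ^+ 2.
  by rewrite sqr_intr_ge1 // !mulf_neq0 ?invr_eq0 // pnatr_eq0 -lt0n.
have z'1 : 1%g \notin z ^: G.
  by apply: contra nt_z => /imsetP[y _ /esym/eqP]; rewrite conjg_eq1.
have split (F : gT -> algC) : {in G &, forall x y, F (x ^ y)%g = F x} ->
  \sum_(x in G) F x
    = F 1%g + m%:R * F z + \sum_(x in G :\: (1%g |: z ^: G)) F x.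
  move=> FJ; rewrite (big_setID (1%g |: z ^: G)) /=; congr (_ + _).
  rewrite (setIidPr _) ?subUset ?sub1set ?group1 ?class_subG //.
  rewrite big_setU1 //=; congr (_ + _).
  rewrite (eq_bigr (fun=> F z)) ?sumr_const ?mulr_natl //.
  by move=> _ /imsetP[y Gy ->]; rewrite FJ.
have dot_c i : \sum_(x in G) 'chi_i x * 'chi_c x = #|G|%:R *+ (i == c).
  have := cfdot_irr i c; rewrite cfdotE => /(canRL (mulVKf (neq0CG G))).
  rewrite mulr_natr => <-; apply: eq_bigr => x _.
  by rewrite [(_ x)^*]conj_intr.
(* The class of [z] contributes at least [d ^ 2 / m >= d ^ 2 / (e - 1)] to
   [\sum_x 'chi_c x ^ 2 = d ^ 2 + d ^ 2 / (e - 1)]. *)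
have [m_eq chi0] :
  m = (e - 1)%N /\ {in G, forall x, x \notin 1%g |: z ^: G -> 'chi_c x = 0}.
  have := dot_c c; rewrite eqxx split => [|x y Gx Gy]; last by rewrite !cfunJ.
  set d := 'chi_c 1%g in nz_d w_ge1 *; set b := 'chi_c z in w_ge1 *.
  set R := \sum_(x in _) _ => sumG.
  have sqr_ge0 x : 0 <= 'chi_c x * 'chi_c x.
    by rewrite -expr2 real_exprn_even_ge0 ?Rreal_int.
  have R_ge0 : 0 <= R by rewrite sumr_ge0.
  have mb2 : d ^+ 2 <= m%:R * (m%:R * (b * b)).
    have d2_gt0 : 0 < d ^+ 2 by rewrite exprn_gt0 // irr1_gt0.
    rewrite mulrA -!expr2 -exprMn; move: w_ge1.
    by rewrite expr_div_n ler_pdivlMr ?mul1r.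
  have dR : m%:R * (m%:R * (b * b)) + m%:R * R = m%:R * (E ^+ 2 * (E - 1)).
    rewrite -mulrDr; congr (_ * _); apply: (addrI (d * d)).
    rewrite addrA sumG mulr1n oG' /d d1; ring.
  have mR0 : m%:R * R <= m%:R * (E ^+ 2 * (E - 1)) - d ^+ 2.
    by rewrite -dR lerBrDr addrC lerD2r.
  have Dd2 : d ^+ 2 = (E - 1) * (E ^+ 2 * (E - 1)) by rewrite /d d1; ring.
  rewrite Dd2 -mulrBl -De1 -natrX -natrM in mR0.
  have m_eq : m = (e - 1)%N.
    apply/eqP; rewrite eqn_leq le_me /= -(ler_nat algC) -subr_ge0.
    have: 0 <= (m%:R - (e - 1)%:R) * (e ^ 2 * (e - 1))%:R :> algC.
      by apply: le_trans mR0; rewrite mulr_ge0.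
    by rewrite pmulr_lge0 // ltr0n muln_gt0 expn_gt0 e_gt0.
  split=> // x Gx z'x; move: mR0.
  rewrite m_eq subrr mul0r pmulr_rle0 ?ltr0n // => R_le0.
  have /eqP : R = 0 by apply/le_anti; rewrite R_le0.
  rewrite psumr_eq0 => [|y _]; last exact: sqr_ge0.
  move/allP/(_ x (mem_index_enum _)).
  by rewrite inE Gx z'x /= mulf_eq0 orbb => /eqP.
(* In the orthogonality relation of ['chi_i] and ['chi_c] only 1 and the class of [z] survive.
   Comparison with the principal character then puts [z] in the kernel of every ['chi_i] with
   [i != c]. *)
have split0 i : i != c ->
  'chi_i 1%g * 'chi_c 1%g + m%:R * ('chi_i z * 'chi_c z) = 0.
  move=> ne_ic; have := dot_c i; rewrite (negPf ne_ic).
  rewrite split => [|x y Gx Gy]; last by rewrite !cfunJ.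
  rewrite [X in _ + X]big1 ?addr0 // => x /setDP[Gx z'x].
  by rewrite chi0 ?mulr0.
have chi_z i : i != c -> 'chi_i z = 'chi_i 1%g.
  move=> ne_ic; have nz0 : 0 != c by rewrite eq_sym.
  have /eqP := split0 0 nz0; rewrite irr0 !cfun1E group1 Gz !mul1r.
  rewrite addrC addr_eq0 => /eqP Dz.
  have /eqP := split0 i ne_ic; rewrite mulrCA Dz mulrN subr_eq0 => /eqP.
  by move/(mulIf nz_d).
pose N := (\bigcap_(i | i != c) cfker 'chi_i)%G.
have nsNG : N <| G.
  apply/andP; split; last first.
    by rewrite norms_bigcap //; apply/bigcapsP => i _; apply: cfker_norm.
  by rewrite /= (bigcap_min 0) 1?eq_sym // cfker_sub.
have Nz : z \in N.
  by apply/bigcapP => i ne_ic; rewrite cfkerEirr inE chi_z.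
have defN : N = 1%g |: z ^: G :> {set gT}.
  apply/eqP; rewrite eqEsubset subUset sub1set group1.
  rewrite class_sub_norm ?normal_norm // Nz !andbT.
  (* At any further [y] in [N] the regular character would be the positive sum [sumD], although
     [y != 1]. *)
  apply/subsetP => y Ny; have Gy := subsetP (normal_sub nsNG) y Ny.
  apply/negPn/negP => z'y; have := reg1 y; have nt_y : y == 1%g = false.
    by apply: contraNF z'y => /eqP->; rewrite !inE eqxx.
  rewrite nt_y (bigD1 c) //= (chi0 y) // mulr0 add0r.
  rewrite (eq_bigr (fun i => 'chi_i 1%g ^+ 2)) => [|i ne_ic].
    by rewrite sumD => /eqP; rewrite pnatr_eq0 muln_eq0 expn_eq0 !gtn_eqF.
  by move/bigcapP: Ny => /(_ i ne_ic); rewrite cfkerEirr inE => /eqP->.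
have defN1 : N^# = z ^: G by rewrite defN setU1K.
exists N; split => //.
- by rewrite (cardsD1 1%g) group1 defN1 -/m m_eq add1n subn1 prednK.
- by move=> x; rewrite defN1 => /class_eqP.
by move=> i ne_ic; rewrite /= (bigcap_min i).
Qed.
End Isaacs.

(** * Matrix actions *)

Lemma abelem_matrix_action (p n : nat) (gT : finGroupType) (E G : {group gT}) :
    p.-abelem E -> #|E| = (p ^ n.+1)%N -> prime p -> G \subset 'N(E) ->
  exists (phi : {morphism E >-> 'rV['F_p]_n.+1})
         (F : {morphism G >-> {'GL_n.+1['F_p]}}),
    [/\ isom E [set: 'rV['F_p]_n.+1] phi, 'ker F = 'C_G(E)
      & {in E & G, forall x g, phi (x ^ g) = (phi x *m GLval (F g))%R}].
Proof.
move=> abE oE p_pr nEG.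
have ntE : E :!=: 1.
  by rewrite -cardG_gt1 oE -[1%N](exp1n n.+1) ltn_exp2r // prime_gt1.
have <- : abelem_dim' E = n by rewrite /abelem_dim' oE pdiv_pfactor // pfactorK.
pose rG := abelem_repr abE ntE nEG.
exists [morphism of abelem_rV abE ntE], (reprGL_morphism rG).
split; first exact: abelem_rV_isom.
  by rewrite ker_reprGLm rker_abelem.
move=> x g Ex Gg /=; rewrite (abelem_rV_J abE ntE nEG) //.
exact: (congr1 (mulmx (abelem_rV abE ntE x)) (esym (val_reprGLm rG Gg))).
Qed.

(** Frobenius is trivial on the prime field, so the determinant equals its [p ^ k]-th power, which
    is the determinant of 1 when [u] has order [p ^ k]. *)
Lemma SL2_p_elt (p : nat) (u : {'GL_2['F_p]}) :
  prime p -> p.-elt u -> u \in SL2 p.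
Proof.
move=> p_pr /p_natP[k ou]; rewrite inE.
have detX m : (\det (GLval (u ^+ m)) = \det (GLval u) ^+ m)%R.
  elim: m => [|m IHm]; first by rewrite expg0 GL_1E det1.
  by rewrite expgS GL_ME det_mulmx IHm exprS.
have frob (a : 'F_p) m : (a ^+ (p ^ m) = a)%R.
  elim: m => [|m IHm]; first by rewrite expr1.
  by have := expf_card a; rewrite card_Fp // expnSr exprM IHm.
by rewrite -[(\det _)%R](frob _ k) -detX -ou expg_order GL_1E det1.
Qed.

(** The products [diag(a, 1) * u] are distinct, as the determinant recovers [a]. The bound serves to
    show that [G] maps onto [SL2 p]. *)
Lemma leq_card_SL2 (p : nat) :
  prime p -> (#|SL2 p| * p.-1 <= #|'GL_2['F_p]|)%N.
Proof.
move=> p_pr; pose D (a : {unit 'F_p}) : 'M['F_p]_2 :=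
  diag_mx (\row_j (if j == ord0 then FinRing.uval a else 1))%R.
have detD a : (\det (D a) = FinRing.uval a)%R.
  by rewrite det_diag big_ord_recl big_ord1 !mxE mulr1.
have unitD a : (D a \is a GRing.unit)%R by rewrite unitmxE detD (valP a).
pose d a : {'GL_2['F_p]} := FinRing.unit _ (unitD a).
pose f (au : {unit 'F_p} * {'GL_2['F_p]}) := d au.1 * au.2.
have det_f au : au.2 \in SL2 p -> (\det (GLval (f au)) = FinRing.uval au.1)%R.
  rewrite inE => /eqP det_u.
  by rewrite (GL_ME (d au.1)) det_mulmx det_u mulr1; apply: detD.
have inj_f : {in setX setT (SL2 p) &, injective f}.
  move=> [a u] [b v] /setXP[_ SLu] /setXP[_ SLv] fE.
  have eq_ab : a = b.
    by apply: val_inj; rewrite -[LHS](det_f (a, u)) // fE det_f.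
  by move: fE; rewrite /f /= eq_ab => /mulgI ->.
have <- : (#|f @: setX setT (SL2 p)| = #|SL2 p| * p.-1)%N.
  by rewrite card_in_imset // cardsX card_finField_unit card_Fp // mulnC.
by apply/subset_leq_card/subsetP => w _; rewrite inE.
Qed.

(** [A] is normal in the p-group [A <*> P], so it meets the center; having prime order, it lies
    there. *)
Lemma pgroup_cent_prime_card (p : nat) (gT : finGroupType) (P A : {group gT}) :
  p.-group P -> #|A| = p -> prime p -> P \subset 'N(A) -> P \subset 'C(A).
Proof.
move=> pP oA p_pr nAP; have pA : p.-group A by rewrite /pgroup oA pnat_id.
have pAP : p.-group (A <*> P) by rewrite norm_joinEr // pgroupM pA.
have nsAP : A <| A <*> P by rewrite normalYl.
have ntA : A :!=: 1 by rewrite -cardG_gt1 oA prime_gt1.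
have sAZ : A \subset 'Z(A <*> P).
  by rewrite prime_meetG ?oA // (meet_center_nil (pgroup_nil pAP)).
by rewrite centsC (subset_trans sAZ) // subIset // centY subsetIr orbT.
Qed.

(** The map [k |-> k^-1 * k ^ x] is injective, hence onto [K], and [x] inverts its values. Thus
    inversion is a homomorphism on [K]. *)
Lemma invol_fpf_abelian (gT : finGroupType) (K : {group gT}) (x : gT) :
  x \in 'N(K) -> #[x] = 2 -> 'C_K[x] = 1 -> abelian K.
Proof.
move=> nKx ox CK1; have x2 : x * x = 1 by rewrite -expg2 -ox expg_order.
pose f k := k^-1 * k ^ x.
have injf : {in K &, injective f}.
  move=> k l Kk Kl; rewrite /f => eq_kl.
  have El : l ^ x = l * (k^-1 * k ^ x) by rewrite eq_kl mulKVg.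
  apply/esym/eqP; rewrite eq_mulgV1 -in_set1 -[[set 1]]CK1 inE groupM ?groupV //=.
  by apply/cent1P/commgP/conjg_fixP; rewrite conjMg conjVg El mulgA mulgK.
have imf : f @: K = K.
  apply/eqP; rewrite eqEcard card_in_imset ?leqnn // andbT.
  by apply/subsetP=> _ /imsetP[k Kk ->]; rewrite groupM ?groupV ?memJ_norm.
have invK y : y \in K -> y ^ x = y^-1.
  rewrite -{1}imf => /imsetP[k Kk ->].
  by rewrite /f conjMg conjVg -conjgM x2 conjg1 [RHS]invMg invgK.
apply/centsP=> y Ky z Kz; apply: invg_inj.
by rewrite -invK ?groupM // conjMg !invK // invMg.
Qed.

(** * The action on N *)

Section NaturalAction.

Variables (p : nat) (gT : finGroupType) (G N : {group gT}).
Hypotheses (p_pr : prime p) (oG : #|G| = (p ^ 6 * (p ^ 2 - 1))%N).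
Hypotheses (nsNG : N <| G) (oN : #|N| = (p ^ 2)%N).
Hypothesis clN : {in N^#, forall x, x ^: G = N^#}.

Let sNG : N \subset G := normal_sub nsNG.
Let p_gt0 : (0 < p)%N := prime_gt0 p_pr.
Let p_gt1 : (1 < p)%N := prime_gt1 p_pr.
Let p2B1_gt0 : (0 < p ^ 2 - 1)%N.
Proof. by rewrite subn_gt0 (ltn_exp2l 0) ?prime_gt1. Qed.

Let pN : p.-group N.
Proof. by rewrite /pgroup oN pnatX pnat_id. Qed.

Lemma prime_ndvd_sqr_sub1 : ~~ (p %| p ^ 2 - 1)%N.
Proof. by rewrite dvdn_subr ?expn_gt0 ?p_gt0 ?dvdn_exp // dvdn1 gtn_eqF. Qed.

Lemma card_cent1_natural x : x \in N^# -> #|'C_G[x]| = (p ^ 6)%N.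
Proof.
move=> N1x; have := Lagrange (subsetIl G 'C[x]).
have oN1 : #|N^#| = (p ^ 2 - 1)%N by rewrite -oN (cardsD1 1 N) group1 addKn.
by rewrite index_cent1 clN // oG oN1 => /eqP; rewrite eqn_pmul2r // => /eqP.
Qed.

Lemma Sylow_cent1_natural x : x \in N^# -> p.-Sylow(G) 'C_G[x].
Proof.
move=> N1x; rewrite pHallE subsetIl card_cent1_natural // oG.
rewrite partnM ?expn_gt0 ?p_gt0 //.
rewrite part_pnat_id ?pnatX ?pnat_id // part_p'nat ?muln1 ?eqxx //.
by rewrite p'natE ?prime_ndvd_sqr_sub1.
Qed.

Lemma minnormal_natural : minnormal N G.
Proof.
rewrite /minnormal; apply/mingroupP; split=> [|H /andP[ntH nHG] sHN].
  by rewrite normal_norm // andbT -cardG_gt1 oN (ltn_exp2l 0).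
have [h Hh nt_h] := trivgPn _ ntH; apply/eqP; rewrite eqEsubset sHN /=.
rewrite -(setD1K (group1 N)) subUset sub1G /= -(clN (x := h)).
  by rewrite class_sub_norm.
by rewrite !inE nt_h (subsetP sHN).
Qed.

Lemma abelem_natural : p.-abelem N.
Proof.
rewrite -(is_abelem_pgroup pN).
by have [] := minnormal_solvable minnormal_natural (subxx _) (pgroup_sol pN).
Qed.
Let abN := abelem_natural.
Let order_N x : x \in N^# -> #[x] = p.
Proof. by case/setD1P=> nt_x Nx; apply: (abelem_order_p abN). Qed.

Lemma cycle_eq_natural x y : y \in N^# -> x \in <[y]> -> x != 1 -> y \in <[x]>.
Proof.
move=> N1y y_x nt_x; have Ny := setD1P N1y.
have : <[x]> == <[y]>.
  rewrite eqEcard cycle_subG y_x -!orderE !order_N ?leqnn //.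
  by rewrite !inE nt_x (subsetP _ _ y_x) // cycle_subG; case: Ny.
by move/eqP->; rewrite cycle_id.
Qed.

(** The p-group ['C_G[x]] centralizes [N / <[x]>], which has order [p]. *)
Lemma orbit_sub_natural x y :
  x \in N^# -> y \in N -> y ^: 'C_G[x] \subset y *: <[x]>.
Proof.
move=> N1x Ny; have [nt_x Nx] := setD1P N1x.
have sxN : <[x]> \subset N by rewrite cycle_subG.
have pC := pHall_pgroup (Sylow_cent1_natural N1x).
have nxC : 'C_G[x] \subset 'N(<[x]>).
  by rewrite cents_norm // cent_cycle subsetIr.
have nxN : N \subset 'N(<[x]>).
  by rewrite sub_abelian_norm ?(abelem_abelian abN).
have : 'C_G[x] / <[x]> \subset 'C(N / <[x]>).
  apply: (@pgroup_cent_prime_card p) => //; first exact: quotient_pgroup.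
    by rewrite card_quotient // -divgS // oN -orderE order_N // expnS expn1 mulnK.
  by rewrite quotient_norms // subIset // normal_norm.
rewrite quotient_cents2 // => sCx; apply/subsetP => _ /imsetP[g Cg ->].
rewrite mem_lcoset -commgEl -groupV invg_comm; apply: (subsetP sCx).
by rewrite mem_commg.
Qed.

Lemma natural_span x y : x \in N^# -> y \in N -> y \notin <[x]> ->
  <[x]> <*> <[y]> = N.
Proof.
move=> N1x Ny x'y; have [nt_x Nx] := setD1P N1x.
have sxyN : <[x]> <*> <[y]> \subset N by rewrite join_subG !cycle_subG Nx.
apply/eqP; rewrite eqEcard sxyN oN /=.
have ltxy : (#|<[x]>| < #|<[x]> <*> <[y]>|)%N.
  rewrite proper_card // properE joing_subl; apply: contra x'y => sxyx.
  by rewrite -cycle_subG (subset_trans _ sxyx) ?joing_subr.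
have := cardSg sxyN; rewrite oN => /(dvdn_pfactor _ _ p_pr)[[|[|[|k]]] // _ oxy].
- by move: ltxy; rewrite oxy ltnNge cardG_gt0.
- by move: ltxy; rewrite oxy -orderE order_N // ltnn.
by rewrite oxy.
Qed.

Lemma cent1_cent1_natural x y : x \in N^# -> y \in N -> y \notin <[x]> ->
  'C_('C_G[x])[y] = 'C_G(N).
Proof.
move=> N1x Ny x'y; rewrite -(natural_span N1x Ny x'y) centY !cent_cycle.
by rewrite setIA.
Qed.

(** * Transvections on [N] and generation of [G] *)

Local Notation K := 'C_G(N).
Hypothesis nclosedG : forall x, x \in N^# -> 'C_G[x] != K.

(** ['C_G[x]] induces all transvections fixing [x]: the stabilizer of [y] is [K], a proper subgroup
    of a p-group, so the orbit has at least [p] points. *)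
Lemma orbit_natural x y : x \in N^# -> y \in N -> y \notin <[x]> ->
  y ^: 'C_G[x] = y *: <[x]>.
Proof.
move=> N1x Ny x'y; apply/eqP; rewrite eqEcard orbit_sub_natural //.
have oxy : #|y *: <[x]>| = p by rewrite card_lcoset -orderE order_N.
rewrite oxy -index_cent1 cent1_cent1_natural //.
have sKC : K \subset 'C_G[x].
  by rewrite -(cent1_cent1_natural N1x Ny x'y) subsetIl.
have : (p %| #|'C_G[x] : K|)%N.
  have pC := pHall_pgroup (Sylow_cent1_natural N1x).
  have /(p_natP)[] := pnat_dvd (dvdn_indexg _ K) pC.
  case=> [|k ->]; last by rewrite expnS dvdn_mulr.
  rewrite expn0 => /eqP; rewrite indexg_eq1 => sCK.
  by case/negP: (nclosedG N1x); rewrite eqEsubset sCK.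
by apply: dvdn_leq; rewrite indexg_gt0.
Qed.

Let N_dep x : x \in N^# -> exists2 y, y \in N & y \notin <[x]>.
Proof.
move=> N1x; apply/subsetPn; apply: contraTN isT => sNx.
have := subset_leq_card sNx; rewrite oN -orderE order_N // leqNgt.
by rewrite -[X in (X < _)%N]expn1 ltn_exp2l.
Qed.

Lemma index_cent_natural x : x \in N^# -> #|'C_G[x] : K| = p.
Proof.
move=> N1x; have [y Ny x'y] := N_dep N1x.
rewrite -(cent1_cent1_natural N1x Ny x'y) index_cent1 orbit_natural //.
by rewrite card_lcoset -orderE order_N.
Qed.

Lemma card_cent_natural : #|K| = (p ^ 5)%N.
Proof.
have /trivgPn[x Nx nt_x] : N :!=: 1 by have /mingroupp/andP[] := minnormal_natural.
have N1x : x \in N^# by rewrite !inE nt_x.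
have sKC : K \subset 'C_G[x] by rewrite setIS // -cent_set1 centS // sub1set.
have := Lagrange sKC; rewrite index_cent_natural // card_cent1_natural //.
by rewrite expnSr => /eqP; rewrite eqn_pmul2r // => /eqP.
Qed.

(* When [v] and [w] are independent, an element of ['C_G[v^-1 * w]] maps [v] to
   [v * (v^-1 * w)]; otherwise go through a third vector [t]. *)
Lemma transitive_natural (H : {group gT}) :
    {in N^#, forall x, 'C_G[x] \subset H} ->
  {in N^# &, forall v w, exists2 h, h \in H & w = v ^ h}.
Proof.
move=> sCH.
have move_ind v w : v \in N^# -> w \in N^# -> w \notin <[v]> ->
  exists2 h, h \in H & w = v ^ h.
- move=> N1v N1w v'w; have [nt_v Nv] := setD1P N1v.
  have [nt_w Nw] := setD1P N1w.
  have N1u : v^-1 * w \in N^#.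
    rewrite !inE groupM ?groupV // andbT -eq_mulVg1.
    by apply: contraNneq v'w => <-; apply: cycle_id.
  have u'v : v \notin <[v^-1 * w]>.
    apply: contra v'w => u_v; have := cycle_eq_natural N1u u_v nt_v.
    by rewrite groupMl // groupV cycle_id.
  have : w \in v *: <[v^-1 * w]>.
    by rewrite mem_lcoset cycle_id.
  rewrite -orbit_natural // => /imsetP[h Ch ->].
  by exists h; rewrite // (subsetP (sCH _ N1u)).
move=> v w N1v N1w.
have [v_w | v'w] := boolP (w \in <[v]>); last exact: move_ind.
have [t Nt v't] := N_dep N1v.
have N1t : t \in N^# by rewrite !inE Nt andbT; apply: contraNneq v't => ->.
have [nt_w _] := setD1P N1w.
have t'w : w \notin <[t]>.
  apply: contra v't => t_w; have := cycle_eq_natural N1t t_w nt_w.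
  by apply: subsetP; rewrite cycle_subG.
have [h1 Hh1 Dt] := move_ind v t N1v N1t v't.
have [h2 Hh2 Dw] := move_ind t w N1t N1w t'w.
by exists (h1 * h2); rewrite ?groupM // conjgM -Dt.
Qed.

(** [H] is transitive on [N^#] and contains a point stabilizer of [G], so the orders agree. *)
Lemma natural_gen (H : {group gT}) :
  H \subset G -> {in N^#, forall x, 'C_G[x] \subset H} -> H :=: G.
Proof.
move=> sHG sCH; apply/eqP; rewrite eqEcard sHG /=.
have /trivgPn[x Nx nt_x] : N :!=: 1 by have /mingroupp/andP[] := minnormal_natural.
have N1x : x \in N^# by rewrite !inE nt_x.
have clH : x ^: H = N^#.
  apply/eqP; rewrite eqEsubset; apply/andP; split.
    by rewrite -(clN N1x) classS.
  apply/subsetP=> y N1y; have [h Hh ->] := transitive_natural sCH N1x N1y.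
  exact: imset_f.
have defC : 'C_H[x] = 'C_G[x].
  by apply/eqP; rewrite eqEsubset setSI // subsetI sCH // subsetIr.
rewrite -(Lagrange (subsetIl H 'C[x])) index_cent1 clH /= defC oG.
rewrite card_cent1_natural //.
by rewrite -oN (cardsD1 1 N) group1 addKn.
Qed.

(** Each ['C_G[x]] is a p-group, hence centralizes the section of order [p], and these subgroups
    generate [G]. *)
Lemma natural_cent_chief (A B : {group gT}) :
  A <| G -> B <| G -> B \subset A -> #|A : B| = p -> [~: A, G] \subset B.
Proof.
move=> /andP[sAG nAG] /andP[sBG nBG] sBA oAB.
have nBA := subset_trans sAG nBG.
suffices defG : (G :&: coset B @*^-1 'C(A / B))%G :=: G.
  rewrite -quotient_cents2 // centsC sub_quotient_pre //; exact/setIidPl.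
apply: natural_gen (subsetIl _ _) _ => x N1x; rewrite subsetI subsetIl /=.
have nBC : 'C_G[x] \subset 'N(B) by rewrite subIset ?nBG.
rewrite -sub_quotient_pre //; apply: (@pgroup_cent_prime_card p) => //.
- exact: quotient_pgroup (pHall_pgroup (Sylow_cent1_natural N1x)).
- by rewrite card_quotient.
by rewrite quotient_norms // subIset ?nAG.
Qed.

(** Centralizers of nontrivial elements of [N] are p-groups. *)
Lemma natural_p'cent (x : gT) : x \in G -> ~~ (p %| #[x])%N -> x != 1 ->
  'C_N[x] = 1.
Proof.
move=> Gx p'x nt_x; apply/trivgP/subsetP=> y /setIP[Ny xy]; rewrite inE.
apply: contraR p'x => nt_y; have N1y : y \in N^# by rewrite !inE nt_y.
have Cx : x \in 'C_G[y] by rewrite inE Gx cent1C.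
have pC := pHall_pgroup (Sylow_cent1_natural N1y).
have /p_natP[[|k ->]] : p.-nat #[x] by rewrite -/(p_elt p x) (mem_p_elt pC).
  by move/eqP; rewrite expn0 order_eq1 (negPf nt_x).
by rewrite expnS dvdn_mulr.
Qed.

(** [n * n ^ x] is fixed by [x], hence trivial. *)
Lemma natural_invol x : odd p -> x \in G -> #[x] = 2 ->
  {in N, forall n, n ^ x = n^-1}.
Proof.
move=> p_odd Gx ox n Nn; have cNN := abelem_abelian abN.
have nt_x : x != 1 by rewrite -order_gt1 ox.
have Nnx : n ^ x \in N by rewrite memJ_norm // (subsetP (normal_norm nsNG)).
apply/eqP; rewrite eq_sym eq_invg_mul.
have : n * n ^ x \in 'C_N[x].
  rewrite inE groupM //=; apply/cent1P/commgP/conjg_fixP.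
  rewrite conjMg -conjgM -expg2 -ox expg_order conjg1.
  exact: (centsP cNN).
rewrite natural_p'cent // ?inE // ox dvdn_prime2 //.
by apply: contraTneq p_odd => ->.
Qed.

Let nsKG : K <| G.
Proof. by have := subcent_normal G N; rewrite (setIidPl (normal_norm nsNG)). Qed.
Let pK : p.-group K.
Proof. by rewrite /pgroup card_cent_natural pnatX pnat_id. Qed.
Let sNK : N \subset K.
Proof. by rewrite subsetI sNG; exact: (abelem_abelian abN). Qed.

(** Inversion of [N] commutes with every automorphism of [N], and [K] is the kernel of the
    action. *)
Lemma natural_invol_central x : odd p -> x \in G -> #[x] = 2 ->
  [~: <[x]>, G] \subset K.
Proof.
move=> p_odd Gx ox; have nKG := normal_norm nsKG.
have nNG := subsetP (normal_norm nsNG).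
have NKx := subsetP nKG x Gx.
rewrite -quotient_cents2 ?cycle_subG // quotient_cycle // cycle_subG.
apply/centP=> _ /morphimP[g NKg Gg ->]; apply/commgP.
rewrite -morphR //; apply/eqP/coset_id; rewrite inE groupR //=.
apply/centP=> n Nn.
apply/esym/commgP/conjg_fixP; rewrite commgEl conjgM.
have -> : x^-1 = x by apply/eqP; rewrite eq_invg_mul -expg2 -ox expg_order.
have nNV : {in G, forall h, n ^ h \in N} by move=> h Gh; rewrite memJ_norm ?nNG.
rewrite [n ^ x]natural_invol // conjVg !conjgM.
rewrite [_ ^ x]natural_invol ?nNV ?groupV //.
by rewrite conjVg conjgKV invgK.
Qed.

Lemma natural_invol_cover_normal x : odd p -> x \in G -> #[x] = 2 ->
  K <*> <[x]> <| G.
Proof.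
move=> p_odd Gx ox; have sxG : <[x]> \subset G by rewrite cycle_subG.
rewrite -quotientYK ?(subset_trans sxG (normal_norm nsKG)) //.
rewrite -[X in _ <| X](quotientGK nsKG) cosetpre_normal.
rewrite sub_center_normal // subsetI quotientS //=.
by rewrite quotient_cents2r ?natural_invol_central.
Qed.

(** * The center and derived subgroup of [K] *)

Hypothesis uniN : forall M : {group gT}, M <| G -> M :!=: 1 -> N \subset M.
Hypothesis nabK : ~~ abelian K.

(** The source of coprime action. For odd [p] an involution is central modulo [K]; for [p = 2], [G]
    has order 192 and a Sylow 3-subgroup gives [K <*> Q] order 96. *)
Lemma natural_p'normal_cover : exists Q : {group gT},
  [/\ ~~ (p %| #|Q|)%N, Q :!=: 1, Q \subset G & K <*> Q <| G].
Proof.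
have nKG := normal_norm nsKG.
have [p2 | p_odd] := eqVneq p 2.
  have [Q sylQ] := Sylow_exists 3 G; have sQG := pHall_sub sylQ.
  have oQ : #|Q| = 3.
    rewrite (card_Hall sylQ) oG p2 (_ : 2 ^ 2 - 1 = 3)%N // partnM //.
    by rewrite part_p'nat ?part_pnat_id ?pnatX ?p'natE.
  exists Q; split; rewrite ?oQ // ?p2 //; first by rewrite -cardG_gt1 oQ.
  apply: index2_normal; first by rewrite join_subG sQG normal_sub.
  have defKQ : K <*> Q = K * Q by rewrite norm_joinEr // (subset_trans sQG).
  rewrite -divgS /= ?join_subG ?sQG ?normal_sub // defKQ.
  by rewrite coprime_cardMg card_cent_natural oQ ?oG p2.
have{}p_odd : odd p by case: (even_prime p_pr) p_odd => // ->.
have [x Gx ox] : {x | x \in G & #[x] = 2}.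
  apply: Cauchy => //; rewrite oG dvdn_mull // dvdn2 oddB ?expn_gt0 ?p_gt0 //.
  by rewrite oddX p_odd.
have sxG : <[x]> \subset G by rewrite cycle_subG.
exists <[x]>%G; split=> //=.
- by rewrite -orderE ox dvdn_prime2 //; apply: contraTneq p_odd => ->.
- by rewrite -cardG_gt1 -orderE ox.
exact: natural_invol_cover_normal.
Qed.

(* [Q] centralizes ['Z(K) / N], which has order at most [p], so if [N] were proper
   then ['C_('Z(K))(Q)] would be a nontrivial normal subgroup of [G] meeting [N]
   trivially. *)
Lemma center_natural : 'Z(K) = N.
Proof.
have sNZ : N \subset 'Z(K) by rewrite subsetI sNK centsC subsetIr.
apply/eqP; rewrite eqEsubset sNZ andbT; apply: contraR nabK => not_sZN.
have oKZ : (#|K / 'Z(K)| * #|'Z(K)| = p ^ 5)%N.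
  rewrite card_quotient ?normal_norm ?center_normal // mulnC.
  by rewrite Lagrange ?center_sub // card_cent_natural.
have /(dvdn_pfactor _ _ p_pr)[j _ oZ] : (#|'Z(K)| %| p ^ 5)%N.
  by rewrite -oKZ dvdn_mull.
have gt_j : (2 < j)%N.
  by rewrite -(ltn_exp2l _ _ p_gt1) -oZ -oN proper_card // properE sNZ.
(* For [j > 3] the quotient [K / 'Z(K)] has order dividing [p], so it is cyclic and [K] is
   abelian. *)
have [j3 | ne_j3] := eqVneq j 3; last first.
  apply: cyclic_center_factor_abelian; have : (#|K / 'Z(K)| %| p)%N.
    rewrite -(@dvdn_pmul2r (p ^ 4)) ?expn_gt0 ?p_gt0 // -expnS -oKZ.
    rewrite dvdn_pmul2l //.
    by rewrite oZ dvdn_exp2l // ltn_neqAle eq_sym ne_j3.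
  case/(primeP p_pr).2/orP => /eqP oq; last by rewrite prime_cyclic // oq.
  by rewrite (card1_trivg oq) cyclic1.
have nsZG : 'Z(K) <| G := char_normal_trans (center_char _) nsKG.
have oZN : #|'Z(K) : N| = p.
  by rewrite -divgS //= oZ oN j3 (expnD _ 1 2) mulnK ?expn_gt0 ?p_gt0.
have cZG := natural_cent_chief nsZG nsNG sNZ oZN.
have [Q [p'Q ntQ sQG nsKQ]] := natural_p'normal_cover.
have nsCG : 'C_('Z(K))(K <*> Q) <| G.
  apply/andP; split; first by rewrite subIset // normal_sub.
  by rewrite normsI ?(normal_norm nsZG) // norms_cent // normal_norm.
have defC : 'C_('Z(K))(K <*> Q) = 'C_('Z(K))(Q).
  by rewrite centY setIA (setIidPl (subsetIr K 'C(K))).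
have nNQ := subset_trans sQG (normal_norm nsNG).
have ntC : 'C_('Z(K))(Q) != 1.
  have : 'C_('Z(K))(Q) / N = 'C_('Z(K) / N)(Q / N).
    apply: coprime_quotient_cent => //; last exact: abelian_sol (center_abelian _).
    by rewrite oZ coprimeXl // prime_coprime.
  have cZQ : 'Z(K) / N \subset 'C(Q / N).
    by rewrite quotient_cents2r // (subset_trans _ cZG) // commgS.
  rewrite (setIidPl cZQ) => eqCZ; apply: contraNneq not_sZN => C1.
  rewrite -quotient_sub1 ?(subset_trans (normal_sub nsZG)) ?normal_norm //.
  by rewrite -eqCZ C1 quotient1.
have := uniN nsCG; rewrite /= defC => /(_ ntC); rewrite subsetI => /andP[_ cQN].
have /trivgPn[x Qx nt_x] := ntQ.
have sNx : N \subset 'C[x].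
  by rewrite (subset_trans cQN) // -cent_set1 centS // sub1set.
have p'x : ~~ (p %| #[x])%N.
  by apply: contra p'Q => /dvdn_trans; apply; apply: order_dvdG.
have := natural_p'cent (subsetP sQG x Qx) p'x nt_x.
rewrite (setIidPl sNx) => N1.
by have /mingroupp/andP[] := minnormal_natural; rewrite N1 eqxx.
Qed.

Lemma natural_der : [/\ K^`(1) = 'Z(K), 'Z(K) = N & ~ semi_extraspecial p K]
            \/ [/\ K^`(1) = 'Z_2(K), #|K^`(1)| = (p ^ 3)%N,
                   'Z(K) = [~: K^`(1), K] & [~: K^`(1), K] = N].
Proof.
have nsK1G : K^`(1) <| G := char_normal_trans (der_char _ _) nsKG.
have sNK1 : N \subset K^`(1).
  by rewrite uniN //; apply: contra nabK => /eqP/derG1P.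
have nNK : K \subset 'N(N) by rewrite subIset // (normal_norm nsNG).
have [sK1N | not_sK1N] := boolP (K^`(1) \subset N); [left | right].
  have defK1 : K^`(1) = N by apply/eqP; rewrite eqEsubset sK1N.
  rewrite center_natural; split=> // -[_ semiK].
  have /trivgPn[x Nx nt_x] : N :!=: 1 by have /mingroupp/andP[] := minnormal_natural.
  have N1x : x \in N^# by rewrite !inE nt_x.
  have sxN : <[x]> \subset N by rewrite cycle_subG.
  have maxM : maximal <[x]> 'Z(K).
    rewrite center_natural p_index_maximal // -divgS // oN -orderE order_N //.
    by rewrite mulnK.
  have := semiK _ maxM; have sxK := subset_trans sxN sNK.
  have nxK : K \subset 'N(<[x]>).
    by rewrite cents_norm // centsC (subset_trans sxN) // centsC subsetIr.
  (* An extraspecial group has order an odd power of [p], but [K / <[x]>] has order [p ^ 4]. *)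
  case/(card_extraspecial (quotient_pgroup _ pK)) => n _.
  rewrite card_quotient // -divgS // card_cent_natural -orderE order_N //.
  rewrite expnS mulKn // => /eqP; rewrite eqn_exp2l // => /eqP/(congr1 odd).
  by rewrite /= odd_double.
have oKN : #|K / N| = (p ^ 3)%N.
  rewrite card_quotient // -divgS // card_cent_natural oN (expnD _ 3 2).
  by rewrite mulnK ?expn_gt0 ?p_gt0.
have nabKN : ~~ abelian (K / N) by apply: contra not_sK1N; apply: der1_min.
have esKN : extraspecial (K / N).
  apply: (p3group_extraspecial (quotient_pgroup _ pK)) => //.
  by rewrite oKN pfactorK.
have oZKN := card_center_extraspecial (quotient_pgroup _ pK) esKN.
have [[_ defZ] _] := esKN; rewrite -quotient_der // in defZ.
have defK1 : K^`(1) = 'Z_2(K).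
  rewrite ucnSn ucn1 center_natural -defZ quotientGK //.
  exact: normalS sNK1 (der_sub _ _) (normalS sNK (normal_sub nsKG) nsNG).
have sK1K : [~: K^`(1), K] \subset N.
  rewrite -quotient_cents2 ?(subset_trans (der_sub _ _)) // defZ; exact: subsetIr.
have eqN : [~: K^`(1), K] = N.
  apply/eqP; rewrite eqEsubset sK1K uniN //.
    apply/andP; split; last by rewrite normsR ?normal_norm.
    by rewrite (subset_trans sK1K) // normal_sub.
  apply: contra not_sK1N => /eqP/commG1P cK1.
  have sK1Z : K^`(1) \subset 'Z(K) by rewrite subsetI der_sub.
  by rewrite (subset_trans sK1Z) // center_natural.
rewrite -defK1 eqN center_natural; split=> //.
rewrite -(Lagrange sNK1) oN -card_quotient ?(subset_trans (der_sub _ _)) //.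
by rewrite defZ oZKN -expnSr.
Qed.

(** The generators ['C_G[x]] of [G] act by p-elements, so with determinant 1, and an order count
    gives all of [SL2 p]. The quotient type depends on the subgroup; a variable [H] can be replaced
    by ['ker F]. *)
Lemma natural_SL2 (H : {group gT}) :
  H :=: K -> G / H \isog SL2 p /\ acts_as_natural_SL2_module p G H N.
Proof.
move=> defH.
have nNG := normal_norm nsNG.
have [phi [F [isophi kerF FJ]]] := abelem_matrix_action abN oN p_pr nNG.
have imF : F @* G = SL2 p.
  have defG : (G :&: F @*^-1 SL2 p)%G :=: G.
    apply: natural_gen (subsetIl _ _) _ => x N1x /=.
    apply/subsetP=> g Cg; have Gg : g \in G by case/setIP: Cg.
    rewrite inE Gg; apply: mem_morphpre => //; apply: SL2_p_elt => //.
    apply: morph_p_elt => //.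
    exact: mem_p_elt (pHall_pgroup (Sylow_cent1_natural N1x)) Cg.
  apply/eqP; rewrite eqEcard; apply/andP; split.
    by rewrite sub_morphim_pre //; apply/setIidPl.
  rewrite -(@leq_pmul2r p.-1); last by rewrite -ltnS prednK.
  apply: leq_trans (leq_card_SL2 p_pr) _.
  rewrite card_GL_2 card_Fp // card_morphim setIid kerF -divgS ?normal_sub //.
  have oGK : (p ^ 6 * (p ^ 2 - 1) %/ p ^ 5 = p * (p ^ 2 - 1))%N.
    by rewrite (expnS p 5) mulnAC mulnC mulKn ?expn_gt0 ?p_gt0.
  have subp2 : (p ^ 2 - 1 = p.-1 * p.+1)%N.
    by rewrite -[X in (_ - X)%N](exp1n 2) subn_sqr subn1 addn1.
  rewrite card_cent_natural oG oGK subp2 -mulnn -!mulnA leq_mul2l leq_mul2l.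
  by rewrite [(p.+1 * _)%N]mulnC leqnn !orbT.
have {H defH}-> : H = ('ker F)%G by apply: val_inj; rewrite /= kerF.
have [g injg gE] : {g : {morphism G / ('ker F)%G >-> {'GL_2['F_p]}} | 'injm g
    & forall A : {set gT}, g @* (A / ('ker F)%G) = F @* A}.
  exact: first_isom F.
have isog : isom (G / 'ker F) (SL2 p) g.
  by apply/isomP; split=> //; rewrite gE imF.
split; first exact: isom_isog (subxx _) isog.
have gF h : h \in G -> g (coset ('ker F) h) = F h.
  move=> Gh; have NFh : h \in 'N('ker F).
    by rewrite (subsetP (normal_norm (ker_normal F))).
  have := gE [set h]; rewrite quotient_set1 // !morphim_set1 ?mem_quotient //.
  exact: set1_inj.
exists g; split=> //; exists phi; split=> // x h Nx Gh.
by rewrite gF // FJ.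
Qed.

(** * The centralizer in [K] of an involution, for odd [p] *)

Section Involution.

Variable x : gT.
Hypotheses (p_odd : odd p) (Gx : x \in G) (ox : #[x] = 2).

Let nNG := normal_norm nsNG.
Let nKG := normal_norm nsKG.
Let sKG := normal_sub nsKG.
Let sxG : <[x]> \subset G.
Proof. by rewrite cycle_subG. Qed.
Let nKx : <[x]> \subset 'N(K) := subset_trans sxG nKG.
Let coKx : coprime #|K| #|<[x]>|.
Proof. by rewrite -orderE ox card_cent_natural coprimeXl // coprimen2. Qed.

(** Frattini argument for the Sylow 2-subgroup [<[x]>] of the normal subgroup [K <*> <[x]>]. *)
Lemma invol_Frattini : K * 'N_G(<[x]>) = G.
Proof.
have defKx : K <*> <[x]> = K * <[x]> by rewrite norm_joinEr.
have sylx : 2.-Sylow(K <*> <[x]>) <[x]>.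
  rewrite pHallE joing_subr /= defKx coprime_cardMg // -orderE ox.
  rewrite partnM ?cardG_gt0 //.
  rewrite part_p'nat ?mul1n ?part_pnat_id ?eqxx //.
  by rewrite card_cent_natural pnatX p'natE // dvdn2 p_odd.
have := Frattini_arg (natural_invol_cover_normal p_odd Gx ox) sylx.
by rewrite /= defKx -mulgA mulSGid // subsetI sxG normG.
Qed.

Lemma invol_norm_capK : 'N_G(<[x]>) :&: K = 'C_K(<[x]>).
Proof.
by rewrite -(coprime_norm_cent nKx coKx) setIC setIA (setIidPl sKG).
Qed.

Let D := 'C_K(<[x]>).

Let tiDN : D :&: N = 1.
Proof.
have nt_x : x != 1 by rewrite -order_gt1 ox.
have p'x : ~~ (p %| #[x])%N.
  by rewrite ox dvdn_prime2 //; apply: contraTneq p_odd => ->.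
apply/trivgP; have <- := natural_p'cent Gx p'x nt_x.
have sDx : D \subset 'C[x] by rewrite -cent_cycle subsetIr.
by rewrite subsetI subsetIr subIset ?sDx.
Qed.

Let nND : D \subset 'N(N).
Proof. by rewrite subIset // (subset_trans sKG). Qed.
Let nKN : K \subset 'N(N) := subset_trans sKG nNG.
Let sDNK : D <*> N \subset K.
Proof. by rewrite join_subG subsetIl. Qed.
Let oDN : #|D <*> N| = (#|D| * p ^ 2)%N.
Proof. by rewrite norm_joinEl // TI_cardMg // oN. Qed.

(** The normalizer of [<[x]>] in [G] normalizes [D], and together with [K] it generates [G]. *)
Let normal_DN : D <*> N <| K -> D <*> N <| G.
Proof.
move=> /andP[_ nDNK]; rewrite /normal (subset_trans sDNK) //= -{1}invol_Frattini.
rewrite mul_subG // normsY ?(subset_trans (subsetIl _ _) nNG) //.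
by rewrite normsI ?(subset_trans (subsetIl _ _) nKG) // norms_cent // subsetIr.
Qed.

(* If [#|D| = p ^ 2], then [G] centralizes the section [K / (D <*> N)] of order
   [p], which [x] ought to invert; if [#|D| = p ^ 3], then [K = D \x N] and
   ['Z(D)] is central in [K] but not in [N]. *)
Lemma card_invol_cent : #|D| = p.
Proof.
have pD : p.-group D := pgroupS (subsetIl _ _) pK.
have [j oD] : {j | #|D| = p ^ j}%N by apply/p_natP.
have le_j3 : (j <= 3)%N.
  have := cardSg sDNK; rewrite oDN oD card_cent_natural -expnD.
  by rewrite dvdn_Pexp2l // addn2.
case: j oD le_j3 => [|[|[|[|//]]]] oD _ //.
(* If [D] is trivial, [x] acts on [K] without nontrivial fixed points, so [K] is abelian. *)
- case/negP: nabK; apply: (@invol_fpf_abelian _ _ x); rewrite ?ox //.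
    by rewrite -cycle_subG.
  by rewrite -cent_cycle; apply/eqP; rewrite trivg_card1 -/D oD.
- have oKDN : #|K : D <*> N| = p.
    rewrite -divgS // oDN oD card_cent_natural -expnD (expnD _ 1 4).
    by rewrite mulnK ?expn_gt0 ?p_gt0.
  have nsDNK : D <*> N <| K.
    by apply: (p_maximal_normal pK); rewrite p_index_maximal ?oKDN.
  have nsDNG := normal_DN nsDNK.
  have cKG := natural_cent_chief nsKG nsDNG sDNK oKDN.
  have : D / (D <*> N) = 'C_(K / (D <*> N))(<[x]> / (D <*> N)).
    apply: coprime_quotient_cent => //; last exact: pgroup_sol pK.
    by rewrite (subset_trans sxG) // normal_norm.
  have cKx : K / (D <*> N) \subset 'C(<[x]> / (D <*> N)).
    by rewrite quotient_cents2r // (subset_trans _ cKG) // commgS.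
  rewrite (setIidPl cKx) => eqDK; have := oKDN; rewrite (_ : #|_ : _| = 1%N).
    by move=> p1; move: p_gt1; rewrite -p1.
  apply/eqP; rewrite indexg_eq1 -quotient_sub1 ?normal_norm // -eqDK.
  by rewrite quotientS1 ?joing_subl.
have defK : D <*> N = K.
  by apply/eqP; rewrite eqEcard sDNK oDN oD card_cent_natural -expnD leqnn.
have ntD : D != 1 by rewrite -cardG_gt1 oD (ltn_exp2l 0).
have := center_nil_eq1 (pgroup_nil pD); rewrite (negPf ntD) => /negbT/negP[].
have sDK : D \subset K := subsetIl _ _.
have sZDK : 'Z(D) \subset K by rewrite subIset ?sDK.
have cZDK : 'Z(D) \subset 'C(K).
  rewrite -defK centY subsetI; apply/andP; split; first exact: subsetIr.
  by rewrite subIset // centsC (subset_trans _ (centS sDK)) // centsC subsetIr.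
have sZDN : 'Z(D) \subset N by rewrite -center_natural subsetI sZDK.
by rewrite -subG1 -tiDN subsetI sZDN andbT subsetIl.
Qed.

(** [K^](1) / N[has order 1 or]p[, so]x[centralizes it, and by coprime action fixed points
    of]x[cover it. Containing]K^[(1)], the subgroup [D <*> N] is normal in [K]. *)
Lemma invol_cent_mul :
  [/\ K^`(1) \subset D <*> N, D <*> N <| G, abelian (D <*> N)
    & D <*> N = D * N].
Proof.
have defDN : D <*> N = D * N by rewrite norm_joinEl.
have sK1 : K^`(1) \subset D <*> N.
  have [[-> -> _] | [_ oK1 _ defN]] := natural_der; first exact: joing_subr.
  have sNK1 : N \subset K^`(1).
    have sK1K : [~: K^`(1), K] \subset K^`(1) by rewrite commg_subl der_norm.
    by rewrite (subset_trans _ sK1K) // defN.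
  have nsK1G : K^`(1) <| G := char_normal_trans (der_char _ _) nsKG.
  have oK1N : #|K^`(1) : N| = p.
    by rewrite -divgS // oK1 oN (expnD _ 1 2) mulnK ?expn_gt0 ?p_gt0.
  have cK1 := natural_cent_chief nsK1G nsNG sNK1 oK1N.
  have : 'C_(K^`(1))(<[x]>) / N = 'C_(K^`(1) / N)(<[x]> / N).
    apply: coprime_quotient_cent; rewrite ?(subset_trans sxG) //.
      by rewrite (coprimeSg (der_sub _ _)).
    exact: solvableS (der_sub _ _) (pgroup_sol pK).
  have cK1x : K^`(1) / N \subset 'C(<[x]> / N).
    by rewrite quotient_cents2r // (subset_trans _ cK1) // commgS.
  rewrite (setIidPl cK1x) => eqK1; have : K^`(1) / N \subset D / N.
    by rewrite -eqK1 quotientS // setSI // der_sub.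
  rewrite quotientSK ?(subset_trans (der_sub _ _) nKN) // => /subset_trans; apply.
  by rewrite mul_subG ?joing_subl ?joing_subr.
split=> //; first exact: normal_DN (sub_der1_normal sK1 sDNK).
rewrite defDN abelianM (abelem_abelian abN).
rewrite cyclic_abelian ?prime_cyclic ?card_invol_cent //.
by rewrite centsC (subset_trans (subsetIl _ _)) // subsetIr.
Qed.

End Involution.

(** Both involutions invert [N], so [x * y^-1] lies in [K], which meets the 2-group [S]
    trivially. *)
Lemma natural_2group_invol (S : {group gT}) x y :
    odd p -> 2.-group S -> S \subset G ->
    x \in S -> y \in S -> #[x] = 2 -> #[y] = 2 ->
  x = y.
Proof.
move=> p_odd S2 sSG Sx Sy ox oy.
have [Gx Gy] := (subsetP sSG x Sx, subsetP sSG y Sy).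
apply/eqP; rewrite eq_mulgV1 -in_set1 -[[set 1]]/(1%g : {set gT}).
have tiKS : K :&: S = 1.
  apply: coprime_TIg; rewrite coprime_sym (pnat_coprime S2) //.
  by rewrite card_cent_natural pnatX p'natE // dvdn2 p_odd.
rewrite -tiKS; apply/setIP; split; last by rewrite groupM ?groupV.
rewrite inE groupM ?groupV //=; apply/centP=> n Nn.
apply/esym/commgP/conjg_fixP.
have -> : y^-1 = y by apply/eqP; rewrite eq_invg_mul -expg2 -oy expg_order.
by rewrite conjgM [n ^ x]natural_invol // conjVg natural_invol // invgK.
Qed.

End NaturalAction.

(** * Characters over N *)

(** By Frobenius reciprocity ['chi_i] is a constituent of a character induced from a linear
    character of [A]. *)
Lemma irr1_leq_abelian_index (gT : finGroupType) (A G : {group gT}) (i : Iirr G) :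
  abelian A -> A \subset G -> ('chi_i 1%g <= #|G : A|%:R)%R.
Proof.
move=> abA sAG; have nz_res : ('Res[A] 'chi_i != 0)%R.
  by apply: contraNneq (irr1_neq0 i) => res0; rewrite -(cfRes1 A) res0 cfunE.
have [j res_j] := neq0_has_constt nz_res.
have lin_j : ('chi_j \is a linear_char)%R by apply: char_abelianP.
have <- : ('Ind[G] 'chi_j 1%g = #|G : A|%:R)%R.
  by rewrite cfInd1 // lin_char1 // mulr1.
by apply: char1_ge_constt; rewrite ?cfInd_char ?irr_char // constt_Ind_Res.
Qed.

(** Some ['chi_k] lies over ['chi_i], hence over [lam]; for [k != c] its restriction to [N] would be
    a multiple of the principal character. *)
Lemma irr_over_sub_cfker (gT : finGroupType) (G K N : {group gT}) (c : Iirr G)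
    (lam : Iirr N) (i : Iirr K) :
    (forall k, k != c -> N \subset cfker 'chi_k)%R ->
    N \subset K -> K \subset G -> lam != 0%R ->
    lam \in irr_constt ('Res[N] 'chi_i)%R ->
  i \in irr_constt ('Res[K] 'chi_c)%R.
Proof.
move=> kerN sNK sKG nz_lam lam_i.
have nz_ind : ('Ind[G] 'chi_i != 0)%R.
  apply: contraNneq (irr1_neq0 i) => ind0; have /eqP := cfInd1 ('chi_i)%R sKG.
  by rewrite ind0 cfunE eq_sym mulf_eq0 (negPf (neq0CiG _ _)).
have [k] := neq0_has_constt nz_ind; rewrite constt_Ind_Res => k_i.
have [<- // | /kerN sNker] := eqVneq k c.
have := constt_Res_trans (cfRes_char K (irr_char k)) k_i lam_i.
rewrite cfResRes // cfRes_sub_ker // irr_consttE cfdotZl -irr0 cfdot_irr.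
by rewrite [_ == lam]eq_sym (negPf nz_lam) mulr0 eqxx.
Qed.

Lemma constt_Res_conj (gT : finGroupType) (G K : {group gT}) (c : Iirr G)
    (i j : Iirr K) :
    K <| G -> i \in irr_constt ('Res[K] 'chi_c)%R ->
    j \in irr_constt ('Res[K] 'chi_c)%R ->
  exists2 g : gT, g \in G & ('chi_j = ('chi_i ^ g)%CF)%R.
Proof.
move=> nsKG res_i; rewrite irr_consttE.
rewrite (Clifford_Res_sum_cfclass nsKG res_i) cfdotZl cfdot_suml.
have [/cfclassP[g Gg ->] | not_ij] := boolP ('chi_j \in ('chi_i ^: G)%CF)%R.
  by exists g.
rewrite big1_seq ?mulr0 ?eqxx // => phi /andP[_ /cfclassP[g Gg Dphi]].
rewrite Dphi -conjg_IirrE cfdot_irr; case: eqP => // eq_j.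
by case/negP: not_ij; apply/cfclassP; exists g; rewrite // -eq_j conjg_IirrE.
Qed.

Theorem theorem5p2 (p : nat) (gT : finGroupType) (G N : {group gT})
    (p_pr : prime p)
    (isaacsG : isaacs_group G (p ^ 2)%N)
    (minN : unique_min_normal N G)
    (nclosedG : ~ p_closed p G) :
  exists K : {group gT},
    [/\ [/\ K <| G, p.-group K, #|K| = (p ^ 5)%N, 'Z(K) = N
          & [/\ K^`(1) = 'Z(K), 'Z(K) = N & ~ semi_extraspecial p K]
            \/ [/\ K^`(1) = 'Z_2(K), #|K^`(1)| = (p ^ 3)%N,
                   'Z(K) = [~: K^`(1), K] & [~: K^`(1), K] = N]],
        G / K \isog SL2 p /\ acts_as_natural_SL2_module p G K N,
        odd p ->
          forall S : {group gT}, 2.-Sylow(G) S ->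
          exists2 Z : {group gT}, unique_subgroup_of_order 2 Z S &
            [/\ G :=: K * 'N_G(Z), G / K \isog SL2 p,
                'N_G(Z) :&: K = 'C_K(Z), cyclic 'C_K(Z) /\ #|'C_K(Z)| = p
              & exists C : {group gT},
                  [/\ C :=: 'C_K(Z) * N, K^`(1) \subset C, C <| G & abelian C]]
      & forall lam : Iirr N, lam != 0%R ->
          forall i j : Iirr K,
            lam \in irr_constt ('Res[N] 'chi_i)%R ->
            lam \in irr_constt ('Res[N] 'chi_j)%R ->
            exists2 g : gT, g \in G & ('chi_j = ('chi_i ^ g)%CF)%R].
Proof.
have p_gt1 := prime_gt1 p_pr; have p_gt0 := prime_gt0 p_pr.
have [_ oG [c chi1]] := isaacsG.
have e_gt2 : (2 < p ^ 2)%N by rewrite (@leq_trans (2 ^ 2)) // leq_exp2r.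
have {}oG : #|G| = ((p ^ 2) ^ 3 * (p ^ 2 - 1))%N.
  by rewrite oG mulnBr muln1 -expnSr.
have {}chi1 : ('chi_c 1%g = (p ^ 2 * (p ^ 2 - 1))%N%:R)%R.
  by rewrite chi1 -mulnn mulnBr muln1.
have p_e : p.-nat (p ^ 2)%N by rewrite pnatX pnat_id.
have [N0 [nsN0G oN0 clN0 kerN0]] :=
  irr_Gagola_subgroup p_pr p_e e_gt2 oG chi1.
rewrite -expnM in oG.
have [sNG mN uniqN] := minN.
have defN0 : N0 = N.
  apply/val_inj/uniqN; rewrite ?normal_sub //.
  exact: minnormal_natural p_pr nsN0G oN0 clN0.
move: nsN0G oN0 clN0 kerN0; rewrite {N0}defN0 => nsNG oN clN kerN.
(* Otherwise ['C_G(N)] would be a normal Sylow p-subgroup. *)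
have nclosed x : x \in N^# -> 'C_G[x] != 'C_G(N).
  move=> N1x; apply/eqP => CxN; case: nclosedG; exists 'C_G(N)%G.
  have := Sylow_cent1_natural p_pr oG oN clN N1x.
  rewrite CxN; split=> //.
  by have := subcent_normal G N; rewrite (setIidPl (normal_norm nsNG)).
have uniN (M : {group gT}) : M <| G -> M :!=: 1 -> N \subset M.
  case/andP=> sMG nMG ntM.
  have [|H minH sHM] :=
    @mingroup_exists _ (fun H => (H :!=: 1) && (G \subset 'N(H))) M.
    by rewrite ntM.
  by rewrite -(uniqN H) // (subset_trans sHM).
have oK := card_cent_natural p_pr oG nsNG oN clN nclosed.
have nsKG : 'C_G(N) <| G.
  by have := subcent_normal G N; rewrite (setIidPl (normal_norm nsNG)).
(* If [K] were abelian, its index [p * (p ^ 2 - 1)] would bound the degree [p ^ 2 * (p ^ 2 - 1)]. *)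
have nabK : ~~ abelian 'C_G(N).
  apply/negP => /(irr1_leq_abelian_index c)/(_ (normal_sub nsKG)).
  rewrite chi1 ler_nat -divgS ?normal_sub // oK oG leqNgt => /negP[].
  rewrite (expnSr p 5) -mulnA mulKn ?expn_gt0 ?p_gt0 // ltn_pmul2r.
    by rewrite -[X in (X < _)%N]expn1 ltn_exp2l.
  by rewrite subn_gt0 (ltn_exp2l 0).
have sNK : N \subset 'C_G(N).
  rewrite subsetI sNG.
  exact: abelem_abelian (abelem_natural p_pr nsNG oN clN).
have [isoSL natSL] :=
  natural_SL2 p_pr oG nsNG oN clN nclosed (erefl 'C_G(N)).
exists 'C_G(N)%G; split.
- split=> //; first by rewrite /pgroup oK pnatX pnat_id.
    exact: center_natural p_pr oG nsNG oN clN nclosed uniN nabK.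
  exact: natural_der p_pr oG nsNG oN clN nclosed uniN nabK.
- by [].
- move=> p_odd S sylS; have [sSG S2 _] := and3P sylS.
  have [x Sx ox] : {x | x \in S & #[x] = 2}.
    apply: Cauchy => //; rewrite (card_Hall sylS) oG.
    have e2 : (2 %| p ^ 2 - 1)%N.
      by rewrite dvdn2 oddB ?expn_gt0 ?p_gt0 // oddX p_odd.
    rewrite p_part dvdn_exp // logn_gt0 mem_primes -oG cardG_gt0 oG.
    by rewrite dvdn_mull.
  have Gx := subsetP sSG x Sx.
  exists <[x]>%G.
    split; rewrite ?cycle_subG //=.
    move=> Y sYS oY; apply/esym/eqP.
    rewrite eqEcard /= -orderE ox oY leqnn andbT.
    have [y Yy oy] : {y | y \in Y & #[y] = 2} by apply: Cauchy; rewrite ?oY.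
    have Sy := subsetP sYS y Yy.
    have -> := natural_2group_invol p_pr oG nsNG oN clN nclosed
      p_odd S2 sSG Sx Sy ox oy.
    by rewrite cycle_subG.
  have oD :=
    card_invol_cent p_pr oG nsNG oN clN nclosed uniN nabK p_odd Gx ox.
  have [sK1 nsDN abDN defDN] :=
    invol_cent_mul p_pr oG nsNG oN clN nclosed uniN nabK p_odd Gx ox.
  split=> //.
  - exact/esym/(invol_Frattini p_pr oG nsNG oN clN nclosed p_odd Gx ox).
  - exact: (invol_norm_capK p_pr oG nsNG oN clN nclosed p_odd Gx ox).
  - by split=> //; rewrite prime_cyclic ?oD.
  by exists ('C_('C_G(N))(<[x]>) <*> N)%G.
move=> lam nz_lam i j lam_i lam_j.
have over k := irr_over_sub_cfker kerN sNK (normal_sub nsKG) nz_lam (i := k).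
exact: constt_Res_conj nsKG (over i lam_i) (over j lam_j).
Qed.
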